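(* Let $G$ be a connected triangle-free graph of order $n$, minimum degree $\delta \geq 3$ and maximum degree $\Delta$, and let $N=n-\Delta+\delta$. Then \[ \mu(G) \leq \frac{2}{3}\cdot\frac{N(N-1)}{n(n-1)}\cdot\frac{n+2\Delta}{\delta} + 7 . \]
   Context: A graph is triangle-free if it contains no $K_3$ as a subgraph. For a connected graph $G$ of order $n\ge2$, $W(G)=\sum_{\{u,v\}\subseteq V(G)} d_G(u,v)$ is the Wiener index (sum of shortest-path distances over unordered pairs of distinct vertices) and $\mu(G)=\binom{n}{2}^{-1}W(G)$ is the average distance. *)

(* Defs.v *)
From HB Require Import structures.
From mathcomp Require Import all_boot all_order all_algebra.
Set Implicit Arguments. Unset Strict Implicit. Unset Printing Implicit Defensive.
Import Order.TTheory GRing.Theory Num.Theory.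

Definition simple_graph (T : finType) (e : rel T) : Prop :=
  irreflexive e /\ symmetric e.

Definition connected_graph (T : finType) (e : rel T) : Prop :=
  forall x y : T, connect e x y.

Definition triangle_free (T : finType) (e : rel T) : Prop :=
  forall x y z : T, e x y -> e y z -> e z x -> False.

Definition deg (T : finType) (e : rel T) (x : T) : nat := #|[set y | e x y]|.

Definition mindeg (T : finType) (e : rel T) : nat :=
  \big[minn/#|T|]_(x : T) deg e x.

Definition maxdeg (T : finType) (e : rel T) : nat :=
  \max_(x : T) deg e x.

Definition walkb (T : finType) (e : rel T) (k : nat) (x y : T) : bool :=
  [exists p : k.-tuple T, path e x p && (last x p == y)].

(* shortest-path distance: least k < #|T| admitting a walk of length k from x
   to y (for a connected graph such a k always exists). *)
Definition dist (T : finType) (e : rel T) (x y : T) : nat :=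
  find (fun k => walkb e k x y) (iota 0 #|T|).

(* Wiener index: sum over unordered pairs {u,v} of distinct vertices,
   computed as half the sum over ordered pairs (dist is symmetric, dist x x = 0). *)
Definition wiener (R : numFieldType) (T : finType) (e : rel T) : R :=
  (\sum_(x : T) \sum_(y : T) (dist e x y)%:R) / 2%:R.

Definition avg_dist (R : numFieldType) (T : finType) (e : rel T) : R :=
  wiener R e / ('C(#|T|, 2))%:R.

(* Main.v *)
Require Import Defs.
From HB Require Import structures.
From mathcomp Require Import all_boot all_order all_algebra.
From mathcomp Require Import zify ring lra.
Set Implicit Arguments. Unset Strict Implicit. Unset Printing Implicit Defensive.
Import Order.TTheory GRing.Theory Num.Theory.
Local Open Scope ring_scope.

(** Grow a list of edges greedily, starting from an edge at a vertex of maximum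
degree, each new edge being at distance exactly 3 from the union of the previous
ones, until every vertex is within distance 3 of an end of a chosen edge.
The neighbourhoods of the chosen edges are pairwise disjoint and, as the graph
is triangle-free, have at least [2 delta] elements each ([Delta + delta] for the
first one). Joining each new edge to an earlier one at distance 3 makes the
chosen edges the nodes of a tree with metric [d], and ends of [f] and [g] are at
distance at most [4 d f g + 1]. Assigning every vertex to a chosen edge whose
neighbourhood contains it, or else to one at distance at most 3, gives
[dist x y <= 4 d (a x) (a y) + 7] and reduces the theorem to a bound on the
weighted Wiener index of a tree, whose node weights are at least [k = 2 delta].
Taking [Delta - delta] off the weight of the first node leaves total weight [N].
The weighted bounds follow by induction on the number of leaves attached. *)

(** * Distances in node-weighted trees *)

Section WeightedTrees.
Local Open Scope nat_scope.
Variable (I : eqType).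

(* [d] is constrained on [s] only; the values elsewhere are junk. *)
Inductive tree_metric (d : I -> I -> nat) : seq I -> Prop :=
| tree_metric1 a : d a a = 0 -> tree_metric d [:: a]
| tree_metric_leaf p v s : tree_metric d s -> p \in s -> v \notin s ->
    d v v = 0 ->
    (forall j, j \in s -> d v j = (d p j).+1 /\ d j v = (d j p).+1) ->
    tree_metric d (v :: s).

Lemma eq_tree_metric (d d' : I -> I -> nat) s :
  {in s &, d =2 d'} -> tree_metric d s -> tree_metric d' s.
Proof.
move=> dd' td; elim: td dd' => {s} [a da|p v s _ IH ps vs dv dvj] dd'.
  by apply: tree_metric1; rewrite -dd' ?mem_head.
have dd's : {in s &, d =2 d'}.
  by move=> x y xs ys; rewrite dd' // inE ?xs ?ys orbT.
apply: (@tree_metric_leaf _ p) => //; first exact: IH.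
  by rewrite -dd' ?mem_head.
move=> j js; have [dvj1 djv1] := dvj j js.
by rewrite -!dd' ?inE ?eqxx ?js ?ps ?orbT.
Qed.

Definition add_leaf (d : I -> I -> nat) (p v x y : I) : nat :=
  if x == v then (if y == v then 0 else (d p y).+1)
  else if y == v then (d x p).+1 else d x y.

Lemma tree_metric_add_leaf d p v s : tree_metric d s -> p \in s -> v \notin s ->
  tree_metric (add_leaf d p v) (v :: s).
Proof.
move=> td ps vs; have neq x : x \in s -> (x == v) = false.
  by move=> xs; apply: contraNF vs => /eqP <-.
apply: (@tree_metric_leaf _ p) => //; rewrite /add_leaf ?eqxx //.
  by apply: eq_tree_metric td => x y xs ys; rewrite !neq.
by move=> j js; rewrite !neq.
Qed.

Lemma tree_metric_uniq d s : tree_metric d s -> uniq s.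
Proof. by elim=> //= p v {}s _ -> _ ->. Qed.

Lemma tree_metric_sym d s : tree_metric d s -> {in s &, forall x y, d x y = d y x}.
Proof.
elim=> [a _ x y|p v {}s _ IH ps vs dv dvj x y].
  by rewrite !inE => /eqP -> /eqP ->.
rewrite !inE => /predU1P[->|xs] /predU1P[->|ys] //; last exact: IH.
- by have [-> ->] := dvj _ ys; rewrite IH.
- by have [-> ->] := dvj _ xs; rewrite IH.
Qed.

Lemma tree_metric0 d s x : tree_metric d s -> x \in s -> d x x = 0.
Proof.
elim=> [a da|p v {}s _ IH ps vs dv dvj]; rewrite !inE.
  by move=> /eqP ->.
by move=> /predU1P[->|/IH].
Qed.

Variables (d : I -> I -> nat) (w : I -> nat) (k : nat).

(** The tree path from [i] to [j] has [d i j] nodes besides [i], each of weight at least [k]. *)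
Lemma tree_metric_bound s : tree_metric d s -> {in s, forall i, k <= w i} ->
  {in s &, forall i j, k * d i j + w i <= \sum_(l <- s) w l}.
Proof.
elim=> [a da|p v {}s _ IH ps vs dv dvj] kw i j.
  by rewrite !inE big_seq1 => /eqP -> /eqP ->; rewrite da muln0.
have kws : {in s, forall i, k <= w i} by move=> l ls; apply: kw; rewrite inE ls orbT.
have kv := kw v (mem_head _ _); have kp := kws p ps.
have {}IH := IH kws.
rewrite big_cons !inE => /predU1P[->|iS] /predU1P[->|jS].
- by rewrite dv; lia.
- by have [-> _] := dvj _ jS; have := IH p j ps jS; lia.
- by have [_ ->] := dvj _ iS; have := IH i p iS ps; lia.
- by have := IH i j iS jS; lia.
Qed.

(** Let [M] be the weight outside [i]. The extreme case is a path of nodes of weight [k] starting at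
    [i], with sum [M(M + k)/(2k)]; the right-hand side completes the square in [4M(M + k)]. *)
Lemma tree_metric_sum_dist s : tree_metric d s -> {in s, forall i, k <= w i} ->
  {in s, forall i, 8 * k * (\sum_(j <- s) w j * d i j) <=
     (2 * (\sum_(j <- s) w j - w i) + k) ^ 2}.
Proof.
elim=> [a da|p v {}s td IH ps vs dv dvj] kw i.
  by rewrite !inE !big_seq1 => /eqP ->; rewrite da; lia.
have kws : {in s, forall i, k <= w i} by move=> l ls; apply: kw; rewrite inE ls orbT.
have kv := kw v (mem_head _ _); have kp := kws p ps.
have {}IH := IH kws; have bd := tree_metric_bound td kws.
rewrite !big_cons !inE => /predU1P[->|iS].
  have -> : \sum_(j <- s) w j * d v j = \sum_(j <- s) w j * d p j + \sum_(j <- s) w j.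
    rewrite -big_split !(big_seq_cond xpredT) /=; apply: eq_bigr => j.
    by rewrite andbT => /dvj[-> _]; rewrite mulnS addnC.
  have := IH p ps; have := bd p p ps ps.
  rewrite dv; move: (\sum_(j <- s) w j) (\sum_(j <- s) _ * _) => W D.
  move=> h; have : w p <= W by lia.
  by move=> /subnK; move: (W - w p) => M <-; nia.
have [_ ->] := dvj _ iS; have := IH i iS; have := bd i p iS ps.
move: (\sum_(j <- s) w j) (\sum_(j <- s) _ * _) => W D h.
have : w i <= W by lia.
have -> : w v + W - w i = w v + (W - w i) by lia.
(* The leaf adds [w v * (d i p).+1]. Bounding [d i p] by the weight outside [i] and using [k <= w v]
   keeps this within the growth of the square. *)
move=> hW; have {h} : k * d i p <= W - w i by lia.
move: (W - w i) (d i p) => M t; nia.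
Qed.

(* Sharp up to lower order terms for a path with all weights [k]. *)
Lemma tree_metric_wiener s : tree_metric d s -> {in s, forall i, k <= w i} ->
  3 * k * (\sum_(i <- s) \sum_(j <- s) w i * w j * d i j) <=
     (\sum_(j <- s) w j) ^ 3.
Proof.
elim=> [a da|p v {}s td IH ps vs dv dvj] kw.
  by rewrite !big_seq1 da; lia.
have kws : {in s, forall i, k <= w i} by move=> l ls; apply: kw; rewrite inE ls orbT.
have kv := kw v (mem_head _ _).
have tv : tree_metric d (v :: s) by apply: (@tree_metric_leaf _ p).
have := tree_metric_sum_dist tv kw (mem_head _ _).
rewrite !big_cons dv !muln0 !add0n addKn.
under [X in _ -> _ * (_ + X) <= _]eq_bigr do rewrite big_cons.
rewrite big_split /=.
have -> : \sum_(j <- s) w v * w j * d v j = w v * \sum_(j <- s) w j * d v j.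
  by rewrite big_distrr /=; apply: eq_bigr => j _; rewrite mulnA.
have -> : \sum_(i <- s) w i * w v * d i v = w v * \sum_(j <- s) w j * d v j.
  rewrite big_distrr /= !(big_seq_cond xpredT); apply: eq_bigr => j.
  rewrite andbT => js; rewrite (tree_metric_sym tv) ?inE ?js ?eqxx ?orbT //; lia.
have {IH} := IH kws.
move: (\sum_(j <- s) w j) (\sum_(j <- s) w j * d v j) (\sum_(i <- s) _) => W D S.
move=> h1 h2.
(* The leaf's contribution [2 * w v * D], times [3 * k], must fit into [(w v + W) ^ 3 - W ^ 3]. The
   distance bound at [v] gives this with [k] in place of [w v], and [k <= w v] does the rest. *)
have h3 : 6 * k * w v * D <= w v * (3 * W ^ 2 + 3 * W * k + k ^ 2).
  have : 6 * k * D <= 3 * W ^ 2 + 3 * W * k + k ^ 2 by nia.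
  by move/(leq_mul (leqnn (w v))); lia.
have h4 : w v * (3 * W ^ 2 + 3 * W * k + k ^ 2) <=
          w v * (3 * W ^ 2 + 3 * W * w v + w v ^ 2).
  rewrite leq_mul2l; apply/orP; right; nia.
have h5 : (w v + W) ^ 3 = W ^ 3 + w v * (3 * W ^ 2 + 3 * W * w v + w v ^ 2) by ring.
rewrite h5; nia.
Qed.

Lemma sum_pred1_seq (s : seq I) r (F : I -> nat) : uniq s -> r \in s ->
  \sum_(i <- s) (i == r) * F i = F r.
Proof.
move=> us rs; rewrite (bigD1_seq r) //= eqxx mul1n big1 ?addn0 // => i.
by move=> /negPf ->.
Qed.

(** The surplus [D] sits at a single node, so it enters the double sum only linearly, as [2 * D]
    times the distance sum of [r]: its square is multiplied by [d r r = 0]. *)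
Lemma tree_metric_wiener_root s r D : tree_metric d s ->
  {in s, forall i, k <= w i} -> r \in s -> 1 < k ->
  let W := \sum_(i <- s) w i in
  let c := fun i => w i + (i == r) * D in
  (3 * k * (\sum_(i <- s) \sum_(j <- s) c i * c j * d i j) <=
    W * (W - 1) * (W + k + 3 * D) : Prop).
Proof.
move=> td kw rs k1 W c.
have us := tree_metric_uniq td.
pose g i := \sum_(j <- s) w j * d i j.
have -> : \sum_(i <- s) \sum_(j <- s) c i * c j * d i j =
    \sum_(i <- s) \sum_(j <- s) w i * w j * d i j + 2 * D * g r.
  transitivity (\sum_(i <- s) (w i * g i +
      (w i * (D * d i r) + (i == r) * (D * g i + D * (D * d i r))))).
    apply: eq_bigr => i _; transitivity (c i * (g i + D * d i r)); last first.
      by rewrite /c; ring.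
    have -> : D * d i r = \sum_(j <- s) (j == r) * (D * d i j).
      by rewrite sum_pred1_seq.
    rewrite -big_split big_distrr /=; apply: eq_bigr => j _.
    by rewrite /c; ring.
  rewrite !big_split /= sum_pred1_seq // (tree_metric0 td rs) !muln0 addn0.
  congr (_ + _).
    apply: eq_bigr => i _; rewrite big_distrr /=.
    by apply: eq_bigr => j _; rewrite mulnA.
  rewrite -mulnA mul2n -addnn; congr (_ + _).
  rewrite /g big_distrr /= !(big_seq_cond xpredT); apply: eq_bigr => i.
  by rewrite andbT => iS; rewrite (tree_metric_sym td) // mulnCA.
have h1 := tree_metric_wiener td kw; have h2 := tree_metric_sum_dist td kw rs.
have h3 := tree_metric_bound td kw rs rs.
have kr := kw r rs.
move: h1 h2 h3; rewrite -/(g r) -/W; move: (\sum_(i <- s) _) (g r) => S G h1 h2 h3.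
have kW : k <= W by lia.
set P := W * (W - 1).
(* Since [k <= w r], the square in [h2] is at most [(2W - k)^2], which [1 < k <= W] brings below
   [4W(W - 1)]. *)
have h4 : 2 * k * G <= P.
  have [m Wm] : exists m, W = k + m by exists (W - k); lia.
  have : 8 * k * G <= (k + 2 * m) ^ 2 by apply: leq_trans h2 _; rewrite leq_sqr; lia.
  have -> : P = (k + m) * (k + m) - (k + m) by rewrite /P Wm mulnBr muln1.
  have := leq_mul k1 (leqnn k); have := leq_mul k1 (leqnn m); lia.
have h5 : W ^ 3 <= P * (W + k).
  rewrite -[W ^ 3]/(W * (W * W)) /P -mulnA leq_mul2l; apply/orP; right.
  have [m Wm] : exists m, W = m.+1 by exists (W - 1); lia.
  have : 0 < m by lia.
  rewrite Wm subn1 /=; have := leq_mul k1 (leqnn m); lia.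
have := leq_mul (leqnn (3 * D)) h4; rewrite mulnDr; move: h1 h5; lia.
Qed.

End WeightedTrees.

(** * Shortest-path distance as a metric *)

Section Distance.
Local Open Scope nat_scope.
Variables (T : finType) (e : rel T).

Lemma walkP k x y :
  reflect (exists p, [/\ path e x p, last x p = y & size p = k]) (walkb e k x y).
Proof.
apply: (iffP existsP) => [[p /andP[ep /eqP <-]]|[p [ep <- sp]]].
  by exists p; rewrite size_tuple.
by exists (Tuple (introT eqP sp)); rewrite /= ep eqxx.
Qed.

Lemma dist_le k x y : walkb e k x y -> dist e x y <= k.
Proof.
move=> wk; rewrite leqNgt; apply/negP => lt_k.
have kT : k < #|T|.
  by apply: leq_trans lt_k _; rewrite -[leqRHS](size_iota 0) find_size.
by have := before_find 0 lt_k; rewrite nth_iota // add0n wk.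
Qed.

Lemma dist_edge x y : e x y -> dist e x y <= 1.
Proof. by move=> exy; apply/dist_le/walkP; exists [:: y]; rewrite /= exy. Qed.

Lemma distxx x : dist e x x = 0.
Proof. by apply/eqP; rewrite -leqn0; apply/dist_le/walkP; exists [::]. Qed.

Hypothesis e_conn : connected_graph e.

(** [find] would return the default [#|T|] if no walk were found. A shortened path repeats no
    vertex, so its length is below [#|T|] and the search succeeds. *)
Lemma walk_dist x y : walkb e (dist e x y) x y.
Proof.
have /connectP[p ep lp] := e_conn x y.
case/shortenP: ep lp => q eq uq _ lq.
have szq : size q < #|T|.
  by have := max_card (mem (x :: q)); rewrite (card_uniqP uq).
have hasP : has (fun k => walkb e k x y) (iota 0 #|T|).
  apply/hasP; exists (size q); first by rewrite mem_iota.
  by apply/walkP; exists q.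
have := nth_find 0 hasP; rewrite nth_iota ?add0n //.
by rewrite /dist -[ltnRHS](size_iota 0) -has_find.
Qed.

Lemma dist_triangle x y z : dist e x z <= dist e x y + dist e y z.
Proof.
have /walkP[p [ep lp <-]] := walk_dist x y.
have /walkP[q [eq lq <-]] := walk_dist y z.
apply/dist_le/walkP; exists (p ++ q).
by rewrite cat_path ep lp eq last_cat lp lq size_cat.
Qed.

Hypothesis e_sym : symmetric e.

Lemma dist_sym_le x y : dist e x y <= dist e y x.
Proof.
have /walkP[p [ep lp <-]] := walk_dist y x.
apply/dist_le/walkP; exists (rev (belast y p)); split.
- rewrite -lp rev_path; apply: sub_path ep => u v.
  by rewrite e_sym.
- by case: p {ep} lp => //= a p _; rewrite rev_cons last_rcons.
- by rewrite size_rev size_belast.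
Qed.

Lemma dist_sym x y : dist e x y = dist e y x.
Proof. by apply/eqP; rewrite eqn_leq !dist_sym_le. Qed.

Lemma boundary_edge (A : {pred T}) x y : x \in A -> y \notin A ->
  exists z t, [/\ z \in A, t \notin A & e z t].
Proof.
move=> xA; have /connectP[p + ->] := e_conn x y.
elim: p x xA => [x -> //|a p IH x xA /= /andP[exa ep] lA].
have [aA|aA] := boolP (a \in A); first exact: (IH a).
by exists x, a.
Qed.

End Distance.

(** * Greedy packing of edges *)

Section EdgePacking.
Local Open Scope nat_scope.
Variables (T : finType) (e : rel T).

Definition edge_ends (f : T * T) : seq T := [:: f.1; f.2].

Definition edge_nbhd (f : T * T) : {set T} := [set y | e f.1 y || e f.2 y].

Definition covers (s : seq (T * T)) (x : T) : bool :=
  has (fun f => has (fun a => dist e x a <= 3) (edge_ends f)) s.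

(** In [4 * d f g + 1], each of the [d f g] tree edges costs a path of length 3, and each of the
    [d f g + 1] chosen edges on the way may have to be crossed. *)
Record edge_packing (s : seq (T * T)) (d : T * T -> T * T -> nat) : Prop :=
  EdgePacking {
    packing_tree : tree_metric d s;
    packing_edge : {in s, forall f, e f.1 f.2};
    packing_disjoint : {in s &, forall f g x,
      x \in edge_nbhd f -> x \in edge_nbhd g -> f = g};
    packing_dist : {in s &, forall f g,
      {in edge_ends f & edge_ends g, forall a b, dist e a b <= 4 * d f g + 1}}
  }.

Hypotheses (e_conn : connected_graph e) (e_sym : symmetric e).

Lemma edge_ends_dist f : e f.1 f.2 ->
  {in edge_ends f &, forall a b, dist e a b <= 1}.
Proof.
move=> ef a b; rewrite !inE.
by do 2![case/orP=> /eqP ->]; rewrite ?distxx ?dist_edge // e_sym.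
Qed.

Lemma edge_packing1 f : e f.1 f.2 -> edge_packing [:: f] (fun _ _ => 0).
Proof.
move=> ef; split; first exact: tree_metric1.
- by move=> g; rewrite inE => /eqP ->.
- by move=> g h; rewrite !inE => /eqP -> /eqP ->.
- by move=> g h; rewrite !inE => /eqP -> /eqP ->; apply: edge_ends_dist.
Qed.

Lemma mem_edge_nbhdP f x :
  reflect (exists2 a, a \in edge_ends f & e a x) (x \in edge_nbhd f).
Proof.
rewrite inE; apply: (iffP orP) => [[]|[a]].
- by exists f.1; rewrite // mem_head.
- by exists f.2; rewrite // !inE eqxx orbT.
- by rewrite !inE => /orP[] /eqP ->; [left|right].
Qed.

Lemma edge_packing_extend s d x0 : edge_packing s d -> ~~ covers s x0 ->
  exists f d', f \notin s /\ edge_packing (f :: s) d'.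
Proof.
move=> [td ed dj ds] x0s.
have far x : ~~ covers s x -> {in s, forall f, {in edge_ends f, forall a, 3 < dist e x a}}.
  move=> + f fs a af; rewrite ltnNge; apply: contra => le3.
  by apply/hasP; exists f => //; apply/hasP; exists a.
have [f0 f0s] : exists f, f \in s.
  by case: td => [a|p v s' *]; [exists a|exists v]; rewrite mem_head.
have cov0 : covers s f0.1.
  by apply/hasP; exists f0 => //; rewrite /= distxx.
(* An edge crossing the boundary of the covered set: [z] is then at distance
   exactly 3 from [s] and [y] at distance 4, so [(z, y)] can be added. *)
have [z [y [zc yc ezy]]] := boundary_edge e_conn (A := covers s) cov0 x0s.
have /hasP[p ps /hasP[b bp zb3]] := zc.
have yfar := far y yc.
have zfar : {in s, forall f, {in edge_ends f, forall a, 3 <= dist e z a}}.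
  move=> f fs a af; have := yfar f fs a af.
  have := dist_triangle e_conn y z a; have := dist_edge (e := e) (x := y) (y := z).
  by rewrite e_sym ezy => /(_ isT); lia.
pose v := (z, y).
have vfar : {in s, forall f, {in edge_ends v & edge_ends f, forall c a, 3 <= dist e c a}}.
  move=> f fs c a; rewrite inE => /predU1P[-> /zfar|]; first exact.
  by rewrite inE => /eqP -> /(yfar f fs) /ltnW.
have vs : v \notin s.
  by apply/negP => /vfar /(_ z z); rewrite mem_head distxx => /(_ isT isT).
(* A common neighbour would put an end of [v] at distance at most 2 from an end of [f]. *)
have vdj : {in s, forall f x, x \in edge_nbhd f -> x \in edge_nbhd v -> False}.
  move=> f fs x /mem_edge_nbhdP[a af eax] /mem_edge_nbhdP[c cv ecx].
  have := vfar f fs c a cv af; have := dist_triangle e_conn c x a.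
  have := dist_edge ecx; rewrite e_sym in eax; have := dist_edge eax; lia.
(* One more tree edge costs 4: at most 1 from [c] to [z], then 3 from [z] to the end [b] of the
   parent [p]. *)
have vds : {in s, forall f, {in edge_ends v & edge_ends f, forall c a,
    dist e c a <= 4 * (d p f).+1 + 1}}.
  move=> f fs c a cv af.
  have h1 : dist e c z <= 1 by apply: (@edge_ends_dist v); rewrite ?mem_head.
  have := ds p f ps fs b a bp af.
  have := dist_triangle e_conn c z a; have := dist_triangle e_conn z b a; lia.
exists v, (add_leaf d p v); split=> //; split.
- exact: tree_metric_add_leaf.
- by move=> f; rewrite inE => /predU1P[->|/ed].
- move=> f g; rewrite !inE => /predU1P[->|fs] /predU1P[->|gs] x // xf xg.
  + by case: (vdj g gs x).
  + by case: (vdj f fs x).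
  + exact: dj xf xg.
- have neq f : f \in s -> (f == v) = false.
    by move=> fs; apply: contraNF vs => /eqP <-.
  move=> f g; rewrite !(inE, in_cons) /add_leaf.
  move=> /predU1P[->|fs] /predU1P[->|gs] a c; rewrite ?eqxx ?(neq f) ?(neq g) //.
  + exact: edge_ends_dist.
  + exact: vds.
  + by move=> af cv; rewrite (dist_sym e_conn e_sym) (tree_metric_sym td) //; apply: vds.
  + exact: ds.
Qed.

Lemma edge_packing_cover f0 : e f0.1 f0.2 ->
  exists s d, [/\ edge_packing s d, f0 \in s & forall x, covers s x].
Proof.
move=> ef0.
(* [m] is fuel: the chosen edges are distinct pairs, so there are at most [#|{: T * T}|] of them. *)
suff H m s d : #|{: T * T}| < m + size s -> edge_packing s d -> f0 \in s ->
    exists s d, [/\ edge_packing s d, f0 \in s & forall x, covers s x].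
  by apply: (H #|{: T * T}| _ _ _ (edge_packing1 ef0)); rewrite ?mem_head // addn1.
elim: m s d => [|m IH] s d lt_m ep f0s.
  have /card_uniqP szs := tree_metric_uniq (packing_tree ep).
  by move: lt_m; rewrite ltnNge add0n -szs max_card.
have [cov|/forallPn[x xs]] := boolP [forall x, covers s x].
  by exists s, d; split=> // x; apply: (forallP cov).
have [f [d' [fs ep']]] := edge_packing_extend ep xs.
by apply: (IH (f :: s) d') => //; rewrite ?inE ?f0s ?orbT //= addnS -addSn.
Qed.

(** Disjointness leaves at most one neighbourhood containing [x], so the last clause can be met. It
    makes the class of [f] contain [edge_nbhd f], hence heavy enough. *)
Lemma covers_assign s d : edge_packing s d -> (forall x, covers s x) ->
  exists a : T -> T * T, forall x, [/\ a x \in s,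
    has (fun c => dist e x c <= 3) (edge_ends (a x)) &
    {in s, forall f, x \in edge_nbhd f -> a x = f}].
Proof.
move=> ep cov; apply: (fin_all_exists (P := fun x f => [/\ f \in s,
    has (fun c => dist e x c <= 3) (edge_ends f) &
    {in s, forall g, x \in edge_nbhd g -> f = g}])) => x.
have [/hasP[f fs xf]|/hasPn nof] := boolP (has (fun f => x \in edge_nbhd f) s).
  exists f; split=> //; last by move=> g gs; apply: (packing_disjoint ep).
  have /mem_edge_nbhdP[c cf ecx] := xf; apply/hasP; exists c => //.
  rewrite e_sym in ecx; have := dist_edge ecx; lia.
have /hasP[f fs xf] := cov x; exists f; split=> // g gs xg.
by have := nof g gs; rewrite xg.
Qed.

(** A common neighbour of the two ends would close a triangle. *)
Lemma card_edge_nbhd f : triangle_free e -> e f.1 f.2 ->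
  #|edge_nbhd f| = deg e f.1 + deg e f.2.
Proof.
move=> tf ef; have -> : edge_nbhd f = [set y | e f.1 y] :|: [set y | e f.2 y].
  by apply/setP => x; rewrite !inE.
rewrite cardsU /deg (_ : _ :&: _ = set0) ?cards0 ?subn0 //.
apply/setP => x; rewrite !inE; apply/negP => /andP[h1 h2].
by apply: (tf _ _ _ ef h2); rewrite e_sym.
Qed.

End EdgePacking.

(** * From the packing to the sum of distances *)

Section SumOfDistances.
Local Open Scope nat_scope.
Variables (T : finType) (e : rel T).

Lemma mindeg_le x : mindeg e <= deg e x.
Proof.
rewrite /mindeg; elim: (index_enum T) (mem_index_enum x) => //= y s IH.
by rewrite inE big_cons geq_min => /predU1P[<-|/IH ->]; rewrite ?leqnn ?orbT.
Qed.

Lemma maxdeg_ge x : deg e x <= maxdeg e.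
Proof. exact: leq_bigmax. Qed.

(** Grouping by fibres of [a] turns sums over vertices into weighted sums over tree nodes. *)
Lemma sum_comp_seq (I : eqType) (s : seq I) (a : T -> I) (F : I -> nat) :
  uniq s -> (forall x, a x \in s) ->
  \sum_x F (a x) = \sum_(f <- s) #|[set x | a x == f]| * F f.
Proof.
move=> us as_.
transitivity (\sum_x \sum_(f <- s) (f == a x) * F f).
  by apply: eq_bigr => x _; rewrite sum_pred1_seq.
rewrite exchange_big /=; apply: eq_bigr => f _.
rewrite -big_distrl /= -sum1dep_card; congr (_ * _); rewrite [RHS]big_mkcond /=.
by apply: eq_bigr => x _; rewrite eq_sym; case: eqP.
Qed.

Lemma sum_neq : \sum_(x : T) \sum_(y : T) (x != y) = #|T| * (#|T| - 1).
Proof.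
rewrite -sum_nat_const; apply: eq_bigr => x _.
rewrite subn1 -(cardC1 x) -sum1_card [RHS]big_mkcond /=; apply: eq_bigr => y _.
by rewrite !inE eq_sym; case: eqP.
Qed.

Hypotheses (e_simple : simple_graph e) (e_conn : connected_graph e).
Hypotheses (tf : triangle_free e) (delta3 : 3 <= mindeg e).

(** This is the theorem multiplied by [6 * delta * n * (n - 1)], with the sum over ordered pairs. *)
Lemma sum_dist_le :
  let n := #|T| in
  let delta := mindeg e in
  let Delta := maxdeg e in
  let N := n - Delta + delta in
  (6 * delta * (\sum_x \sum_y dist e x y) <=
    4 * (N * (N - 1) * (n + 2 * Delta)) + 7 * (6 * delta) * (n * (n - 1)) : Prop).
Proof.
move=> n delta Delta N; have [_ e_sym] := e_simple.
have n_gt0 : 0 < #|T|.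
  (* On an empty type [mindeg] takes its default value [#|T| = 0], against [delta3]. *)
  rewrite lt0n; apply/negP => /eqP /card0_eq T0.
  move: delta3; rewrite /mindeg big_pred0 // (eq_card0 T0) //.
have [v degv] := bigop.eq_bigmax (deg e) n_gt0.
have degv3 : 0 < deg e v by have := mindeg_le v; lia.
have /card_gt0P[u] := degv3; rewrite inE => evu.
have [s [d [ep f0s cov]]] := edge_packing_cover e_conn e_sym (f0 := (v, u)) evu.
have [a aP] := covers_assign e_sym ep cov.
have as_ x : a x \in s by have [] := aP x.
have td := packing_tree ep; have us := tree_metric_uniq td.
pose c f := #|[set x | a x == f]|.
have c_ge f : f \in s -> deg e f.1 + deg e f.2 <= c f.
  move=> fs; rewrite -(card_edge_nbhd e_sym tf (packing_edge ep fs)).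
  apply: subset_leq_card; apply/subsetP => x xf; rewrite inE.
  by have [_ _ /(_ f fs xf) ->] := aP x.
(* The class of the starting edge has at least [Delta + delta] vertices, so removing [D] leaves at
   least [2 * delta] and the subtraction does not truncate. *)
pose D := Delta - delta; pose w f := c f - (f == (v, u)) * D.
have dD : delta <= Delta by apply: leq_trans (mindeg_le v) (maxdeg_ge v).
have cw f : f \in s -> c f = w f + (f == (v, u)) * D /\ 2 * delta <= w f.
  move=> fs; have := c_ge f fs; have := mindeg_le f.1; have := mindeg_le f.2.
  rewrite /w; case: eqP => [->|_] /=; last by rewrite -/delta; lia.
  by rewrite -degv -/(maxdeg e) -/Delta -/delta /D; lia.
have sum_c : \sum_(f <- s) c f = n.
  rewrite -[n]sum1_card (sum_comp_seq (fun _ => 1) us as_).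
  by apply: eq_bigr => f _; rewrite muln1.
have sum_w : \sum_(f <- s) w f = N.
  have : n = \sum_(f <- s) w f + D.
    rewrite -sum_c -[X in _ + X](sum_pred1_seq (fun=> D) us f0s) -big_split /=.
    rewrite !(big_seq_cond xpredT); apply: eq_bigr => f.
    by rewrite andbT => /cw[].
  have : Delta <= n by rewrite /Delta /maxdeg degv max_card.
  by rewrite /N /D; lia.
have kw : {in s, forall f, 2 * delta <= w f} by move=> f /cw[].
have k1 : 1 < 2 * delta by move: delta3; rewrite /delta; lia.
have := tree_metric_wiener_root D td kw f0s k1; rewrite /= sum_w.
have -> : \sum_(f <- s) \sum_(g <- s)
    (w f + (f == (v, u)) * D) * (w g + (g == (v, u)) * D) * d f g =
    \sum_x \sum_y d (a x) (a y).
  rewrite (sum_comp_seq (fun f => \sum_y d f (a y)) us as_).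
  rewrite !(big_seq_cond xpredT); apply: eq_bigr => f; rewrite andbT => fs.
  rewrite (sum_comp_seq (d f) us as_) big_distrr /=.
  rewrite !(big_seq_cond xpredT); apply: eq_bigr => g; rewrite andbT => gs.
  by rewrite -/(c f) -/(c g) -(cw f fs).1 -(cw g gs).1 mulnA.
have -> : N + 2 * delta + 3 * D = n + 2 * Delta.
  have : Delta <= n by rewrite /Delta /maxdeg degv max_card.
  by rewrite /N /D; lia.
(* The 7 is [3 + 1 + 3]: from [x] to an end [p], the constant in the distance from [p] to [q], then
   from [q] to [y]. Pairs with [x = y] contribute 0. *)
have : \sum_x \sum_y dist e x y <=
    4 * (\sum_x \sum_y d (a x) (a y)) + 7 * (n * (n - 1)).
  rewrite /n -sum_neq !big_distrr -big_split /=; apply: leq_sum => x _.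
  rewrite !big_distrr -big_split /=; apply: leq_sum => y _.
  have [->|_] := eqVneq x y; first by rewrite distxx.
  have [xs /hasP[p px xp] _] := aP x; have [ys /hasP[q qy yq] _] := aP y.
  have := packing_dist ep xs ys px qy.
  have := dist_triangle e_conn x p y; have := dist_triangle e_conn p q y.
  by rewrite (dist_sym e_conn e_sym q y); lia.
move: (\sum_x \sum_y _) (\sum_x \sum_y _) => S S' h1 h2.
by move: h2 (leq_mul (leqnn (6 * delta)) h1); lia.
Qed.

End SumOfDistances.

(** * Average distance *)

Theorem theorem5p1 (R : realFieldType) (T : finType) (e : rel T) :
  simple_graph e -> connected_graph e -> triangle_free e ->
  (3 <= mindeg e)%N ->
  let n := #|T| in
  let delta := mindeg e in
  let Delta := maxdeg e in
  let N := (n - Delta + delta)%N in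
  avg_dist R e <=
    (2%:R / 3%:R) * ((N * (N - 1))%:R / (n * (n - 1))%:R)
      * ((n + 2 * Delta)%:R / delta%:R) + 7%:R.
Proof.
move=> es ec tf d3 /=; have /= := sum_dist_le es ec tf d3.
set n := #|T|; set delta := mindeg e; set Delta := maxdeg e.
set N := (n - Delta + delta)%N.
have bin2E : (2 * 'C(n, 2) = n * (n - 1))%N.
  by rewrite mulnC (bin_ffact n 2) ffactnS ffactn1 subn1.
have n1 : (1 < n)%N.
  have : (delta <= n)%N.
    by rewrite /delta /mindeg; elim/big_rec: _ => // x m _; rewrite geq_min orbC => ->.
  by move: d3; rewrite -/delta; lia.
have b_gt0 : 0 < ('C(n, 2))%:R :> R by rewrite ltr0n bin_gt0.
have delta_gt0 : 0 < delta%:R :> R by rewrite ltr0n; apply: leq_trans d3.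
rewrite /avg_dist /wiener -bin2E.
have -> : \sum_(x : T) \sum_(y : T) (dist e x y)%:R =
    (\sum_x \sum_y dist e x y)%N%:R :> R.
  by rewrite natr_sum; apply: eq_bigr => x _; rewrite natr_sum.
move: (\sum_x _)%N => S; clearbody N.
rewrite -(ler_nat R) !(natrD, natrM) -/n.
rewrite -subr_ge0 => h; rewrite -subr_ge0.
move: ('C(n, 2)%:R) (delta%:R) b_gt0 delta_gt0 h => b dl b0 dl0 h.
(* With [n(n - 1) = 2b], the difference of the two sides is that of the integer inequality divided
   by [12 * dl * b]. *)
have -> : 2 / 3 * (N%:R * (N - 1)%:R / (2 * b)) * ((n%:R + 2 * Delta%:R) / dl) + 7
      - S%:R / 2 / b =
   (4 * (N%:R * (N - 1)%:R * (n%:R + 2 * Delta%:R)) + 7 * (6 * dl) * (2 * b) - 6 * dl * S%:R)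
     / (12 * dl * b).
  by field; rewrite !lt0r_neq0.
by rewrite divr_ge0 // !mulr_ge0 // ltW.
Qed.
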